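(* In $\mathbb Z[\Gamma^2]$ one has $I_H\cap I_V\cap I_D=\mathcal I_2$, i.e. the left ideal $I_H\cap I_V\cap I_D$ is generated by the four elements $(1+S,1+S)$, $(S,S)+(S,US)+(US,US)+(1,U)-(U^2,U^2)$, $(1+U+U^2,1)[(1,1)+(S,S)]$ and $(1,1+U+U^2)[(1,1)+(S,S)]$.
   Context: $\Gamma=PSL_2(\mathbb Z)$ acting on $\mathbb P^1(\mathbb Q)$ by Möbius transformations; $S=\pm\begin{pmatrix}0&-1\\1&0\end{pmatrix}$, $U=\pm\begin{pmatrix}0&1\\-1&1\end{pmatrix}$, $T=\pm\begin{pmatrix}1&1\\0&1\end{pmatrix}$. Identify $\mathbb Z[\Gamma^2]=\mathbb Z[\Gamma]\otimes\mathbb Z[\Gamma]$, writing $(a,b)=a\otimes b$ for $a,b\in\mathbb Z[\Gamma]$ (products componentwise). $\mathcal I_2$ denotes the left ideal generated by the four listed elements. Let $\Gamma_\infty=\{T^n\}$ and $\Gamma_0=\{(US)^n\}$ be the stabilizers of $\infty$ and $0$. For $\gamma\in\Gamma$ put $\partial\gamma=[\gamma\infty]-[\gamma0]\in\mathbb Z[\mathbb P^1(\mathbb Q)]$. Write an element of $\mathbb Z[\Gamma^2]$ as $\sum_i\lambda_i(\alpha_i,\beta_i)$ with distinct pairs $(\alpha_i,\beta_i)\in\Gamma^2$. Define $I_H$ as the set of such elements with $\sum_{i:\beta_i\in C}\lambda_i\,\partial\alpha_i=0$ for every coset $C\in\Gamma/\Gamma_\infty$; $I_V$ as those with $\sum_{i:\alpha_i\in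 C}\lambda_i\,\partial\beta_i=0$ for every coset $C\in\Gamma/\Gamma_0$; and $I_D$ as those with $\sum_{i:\beta_i\alpha_i^{-1}=g}\lambda_i\,\partial\alpha_i=0$ for every $g\in\Gamma$. (These encode that $g$ maps the horizontal path from $(\infty,\infty)$ to $(0,\infty)$, the vertical path from $(0,\infty)$ to $(0,0)$, resp. the diagonal path from $(\infty,\infty)$ to $(0,0)$ in $(\mathbb H\cup\mathbb P^1(\mathbb Q))^2$, to closed chains of the same type.) *)

(* Defs.v *)
From Stdlib Require Import ZArith List Lia Bool.
Import ListNotations.
Open Scope Z_scope.

Record mat := M { ma : Z; mb : Z; mc : Z; md : Z }.
Definition det (m : mat) : Z := ma m * md m - mb m * mc m.
Definition mmul (x y : mat) : mat :=
  M (ma x * ma y + mb x * mc y) (ma x * mb y + mb x * md y)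
    (mc x * ma y + md x * mc y) (mc x * mb y + md x * md y).
Definition mneg (m : mat) : mat := M (- ma m) (- mb m) (- mc m) (- md m).
(* canonical representative of {m, -m}: c > 0, or c = 0 and d > 0 *)
Definition posm (m : mat) : bool := (0 <? mc m) || ((mc m =? 0) && (0 <? md m)).
Definition nrm (m : mat) : mat := if posm m then m else mneg m.
Definition eqm (x y : mat) : bool :=
  (ma x =? ma y) && (mb x =? mb y) && (mc x =? mc y) && (md x =? md y).

Lemma det_nrm m : det (nrm m) = det m.
Proof. unfold nrm, det, mneg; destruct (posm m); simpl; ring. Qed.
Lemma posm_nrm m : det m = 1 -> posm (nrm m) = true.
Proof.
  destruct m as [a b c d]; unfold nrm, posm, det, mneg; simpl; intro H.
  destruct ((0 <? c) || (c =? 0) && (0 <? d))%bool eqn:E; simpl; [exact E|].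
  apply Bool.orb_false_iff in E; destruct E as [E1 E2].
  apply Z.ltb_ge in E1. apply Bool.orb_true_iff.
  destruct (Z.eq_dec c 0) as [->|Hc].
  - right. rewrite Z.eqb_refl in E2; simpl in E2. apply Z.ltb_ge in E2.
    apply andb_true_intro; split; [reflexivity|]. apply Z.ltb_lt.
    assert (d <> 0) by (intro; subst; lia). lia.
  - left. apply Z.ltb_lt. lia.
Qed.
Lemma det_mmul x y : det (mmul x y) = det x * det y.
Proof. unfold det, mmul; simpl; ring. Qed.

Record PSL2 := mkG { pm : mat; pm_det : det pm = 1; pm_pos : posm pm = true }.
Definition eqG (g h : PSL2) : bool := eqm (pm g) (pm h).

Lemma det_nrm_mul (x y : PSL2) : det (nrm (mmul (pm x) (pm y))) = 1.
Proof. rewrite det_nrm, det_mmul, (pm_det x), (pm_det y); reflexivity. Qed.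
Lemma pos_nrm_mul (x y : PSL2) : posm (nrm (mmul (pm x) (pm y))) = true.
Proof. apply posm_nrm; rewrite det_mmul, (pm_det x), (pm_det y); reflexivity. Qed.
Definition gmul (x y : PSL2) : PSL2 :=
  mkG (nrm (mmul (pm x) (pm y))) (det_nrm_mul x y) (pos_nrm_mul x y).

Lemma pm_gmul x y : pm (gmul x y) = nrm (mmul (pm x) (pm y)).
Proof. reflexivity. Qed.

Definition madj (m : mat) : mat := M (md m) (- mb m) (- mc m) (ma m).
Lemma det_ginv (x : PSL2) : det (nrm (madj (pm x))) = 1.
Proof. rewrite det_nrm; rewrite <- (pm_det x); unfold det, madj; simpl; ring. Qed.
Lemma pos_ginv (x : PSL2) : posm (nrm (madj (pm x))) = true.
Proof. apply posm_nrm; rewrite <- (pm_det x); unfold det, madj; simpl; ring. Qed.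
Definition ginv (x : PSL2) : PSL2 := mkG (nrm (madj (pm x))) (det_ginv x) (pos_ginv x).

Definition G1 : PSL2 := mkG (M 1 0 0 1) eq_refl eq_refl.
Definition GS : PSL2 := mkG (M 0 (-1) 1 0) eq_refl eq_refl.
(* U = +-[[0,1],[-1,1]] = +-[[0,-1],[1,-1]] (normalized representative) *)
Definition GU : PSL2 := mkG (M 0 (-1) 1 (-1)) eq_refl eq_refl.
Definition GT : PSL2 := mkG (M 1 1 0 1) eq_refl eq_refl.

Definition gpow (g : PSL2) (n : Z) : PSL2 :=
  match n with
  | Z0 => G1
  | Zpos p => Nat.iter (Pos.to_nat p) (gmul g) G1
  | Zneg p => Nat.iter (Pos.to_nat p) (gmul (ginv g)) G1
  end.

Definition in_Ginf (g : PSL2) : Prop := exists n : Z, pm g = pm (gpow GT n).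
Definition in_G0 (g : PSL2) : Prop := exists n : Z, pm g = pm (gpow (gmul GU GS) n).

Definition in_Ginfb (g : PSL2) : bool := mc (pm g) =? 0.
Definition in_G0b (g : PSL2) : bool := mb (pm g) =? 0.

Lemma pm_iter_T (k : nat) : pm (Nat.iter k (gmul GT) G1) = M 1 (Z.of_nat k) 0 1.
Proof.
  induction k as [|k IH]; [reflexivity|].
  rewrite Nat2Z.inj_succ; simpl Nat.iter; unfold gmul at 1; simpl pm; rewrite IH.
  set (z := Z.of_nat k) in *; clearbody z.
  unfold nrm, mmul, posm, mneg; simpl; f_equal; destruct z as [|p|p]; simpl; try reflexivity; try lia; destruct p; reflexivity.
Qed.
Lemma pm_iter_Ti (k : nat) : pm (Nat.iter k (gmul (ginv GT)) G1) = M 1 (- Z.of_nat k) 0 1.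
Proof.
  induction k as [|k IH]; [reflexivity|].
  rewrite Nat2Z.inj_succ; simpl Nat.iter; unfold gmul at 1; simpl pm; rewrite IH.
  set (z := Z.of_nat k) in *; clearbody z.
  unfold nrm, mmul, posm, mneg; simpl; f_equal; destruct z as [|p|p]; simpl; try reflexivity; try lia; destruct p; reflexivity.
Qed.
Lemma pm_gpow_T (n : Z) : pm (gpow GT n) = M 1 n 0 1.
Proof.
  destruct n as [|p|p]; simpl gpow; [reflexivity| |].
  - rewrite pm_iter_T, positive_nat_Z; reflexivity.
  - rewrite pm_iter_Ti, positive_nat_Z; reflexivity.
Qed.

Lemma pm_iter_US (k : nat) :
  pm (Nat.iter k (gmul (gmul GU GS)) G1) = M 1 0 (Z.of_nat k) 1.
Proof.
  induction k as [|k IH]; [reflexivity|].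
  rewrite Nat2Z.inj_succ; simpl Nat.iter; unfold gmul at 1; simpl pm; rewrite IH.
  assert (0 <= Z.of_nat k) by lia.
  set (z := Z.of_nat k) in *; clearbody z.
  unfold nrm, mmul, posm, mneg; simpl.
  destruct z as [|p|p]; simpl in *; try lia; try reflexivity; destruct p; reflexivity.
Qed.
Lemma pm_iter_USi (k : nat) :
  pm (Nat.iter (S k) (gmul (ginv (gmul GU GS))) G1) = M (-1) 0 (Z.of_nat (S k)) (-1).
Proof.
  induction k as [|k IH]; [reflexivity|].
  change (Nat.iter (S (S k)) (gmul (ginv (gmul GU GS))) G1)
    with (gmul (ginv (gmul GU GS)) (Nat.iter (S k) (gmul (ginv (gmul GU GS))) G1)).
  rewrite (pm_gmul (ginv (gmul GU GS))), IH.
  unfold nrm, mmul, posm; simpl.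
  replace (0 <? - Z.pos (Pos.of_succ_nat k) + -1) with false
    by (symmetry; apply Z.ltb_ge; lia).
  replace (- Z.pos (Pos.of_succ_nat k) + -1 =? 0) with false
    by (symmetry; apply Z.eqb_neq; lia).
  unfold mneg; simpl; f_equal; destruct (Pos.of_succ_nat k); reflexivity.
Qed.

Lemma posm_iff m : posm m = true <-> 0 < mc m \/ (mc m = 0 /\ 0 < md m).
Proof.
  unfold posm. rewrite Bool.orb_true_iff, Bool.andb_true_iff, Z.ltb_lt, Z.eqb_eq, Z.ltb_lt.
  reflexivity.
Qed.

Lemma in_Ginfb_spec (g : PSL2) : in_Ginfb g = true <-> in_Ginf g.
Proof.
  unfold in_Ginfb, in_Ginf; split.
  - intro H; apply Z.eqb_eq in H. exists (mb (pm g)). rewrite pm_gpow_T.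
    pose proof (pm_det g) as D; pose proof (pm_pos g) as P. apply posm_iff in P.
    destruct (pm g) as [a b c d]; unfold det in *; simpl in *; subst c.
    assert (E : a * d = 1) by lia.
    assert (a = 1 /\ d = 1) as [-> ->].
    { destruct (Z.eq_mul_1 _ _ E); subst; lia. }
    reflexivity.
  - intros [n Hn]. rewrite Hn, pm_gpow_T; reflexivity.
Qed.

Lemma in_G0b_spec (g : PSL2) : in_G0b g = true <-> in_G0 g.
Proof.
  unfold in_G0b, in_G0; split.
  - intro H; apply Z.eqb_eq in H.
    pose proof (pm_det g) as D; pose proof (pm_pos g) as P. apply posm_iff in P.
    destruct (pm g) as [a b c d]; unfold det in *; simpl in *; subst b.
    assert (E : a * d = 1) by lia.
    assert ((a = 1 /\ d = 1) \/ (a = -1 /\ d = -1)) as [[-> ->]|[-> ->]].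
    { destruct (Z.eq_mul_1 _ _ E); subst; lia. }
    + assert (0 <= c) as Hc by lia.
      exists c. destruct c as [|p|p]; [reflexivity| |lia].
      simpl gpow. rewrite pm_iter_US, positive_nat_Z; reflexivity.
    + assert (0 < c) as Hc by lia.
      exists (- c). destruct c as [|p|p]; try lia. simpl gpow.
      destruct (Pos.to_nat p) as [|k] eqn:Ek; [lia|].
      rewrite pm_iter_USi. rewrite <- Ek, positive_nat_Z; reflexivity.
  - intros [n Hn]. rewrite Hn. destruct n as [|p|p]; simpl gpow; [reflexivity| |].
    + rewrite pm_iter_US; reflexivity.
    + destruct (Pos.to_nat p) as [|k]; [reflexivity|]. rewrite pm_iter_USi; reflexivity.
Qed.

(* A point of P^1(Q) is represented by any nonzero integer vector (p,q) = [p:q];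
   two vectors give the same point iff p q' = p' q. *)
Definition pt := (Z * Z)%type.
Definition pt_nonzero (x : pt) : Prop := fst x <> 0 \/ snd x <> 0.
Definition pt_eqb (x y : pt) : bool := fst x * snd y =? fst y * snd x.
Definition act (g : PSL2) (x : pt) : pt :=
  (ma (pm g) * fst x + mb (pm g) * snd x, mc (pm g) * fst x + md (pm g) * snd x).
Definition pinf : pt := (1, 0).
Definition pzero : pt := (0, 1).
Definition ZP1 := list (Z * pt).
Definition coeffP (s : ZP1) (y : pt) : Z :=
  fold_right (fun e acc => (if pt_eqb (snd e) y then fst e else 0) + acc) 0 s.
Definition ZP1_zero (s : ZP1) : Prop := forall y, pt_nonzero y -> coeffP s y = 0.
Definition bd (g : PSL2) : ZP1 := [(1, act g pinf); (-1, act g pzero)].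
Definition scaleP (l : Z) (s : ZP1) : ZP1 := map (fun e => (l * fst e, snd e)) s.

(* formal Z-combinations sum_i l_i (alpha_i, beta_i); the element of the group
   ring is its coefficient function coeff2 *)
Definition ZG2 := list (Z * (PSL2 * PSL2)).
Definition coeff2 (x : ZG2) (g : PSL2 * PSL2) : Z :=
  fold_right (fun e acc =>
    (if (eqG (fst (snd e)) (fst g) && eqG (snd (snd e)) (snd g))%bool then fst e else 0) + acc) 0 x.
Definition eqZG2 (x y : ZG2) : Prop := forall g, coeff2 x g = coeff2 y g.
Definition mulZG2 (x y : ZG2) : ZG2 :=
  flat_map (fun e => map (fun f => (fst e * fst f,
     (gmul (fst (snd e)) (fst (snd f)), gmul (snd (snd e)) (snd (snd f))))) y) x.
Definition negZG2 (x : ZG2) : ZG2 := map (fun e => (- fst e, snd e)) x.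
Definition ZG := list (Z * PSL2).
Definition tens (a b : ZG) : ZG2 :=
  flat_map (fun e => map (fun f => (fst e * fst f, (snd e, snd f))) b) a.
Definition gen (g : PSL2) : ZG := [(1, g)].

Definition GUS := gmul GU GS.
Definition GU2 := gmul GU GU.

Definition gen1 : ZG2 := tens [(1, G1); (1, GS)] [(1, G1); (1, GS)].
Definition gen2 : ZG2 :=
  tens (gen GS) (gen GS) ++ tens (gen GS) (gen GUS) ++ tens (gen GUS) (gen GUS)
  ++ tens (gen G1) (gen GU) ++ negZG2 (tens (gen GU2) (gen GU2)).
Definition one_plus_SS : ZG2 := tens (gen G1) (gen G1) ++ tens (gen GS) (gen GS).
Definition gen3 : ZG2 :=
  mulZG2 (tens [(1, G1); (1, GU); (1, GU2)] (gen G1)) one_plus_SS.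
Definition gen4 : ZG2 :=
  mulZG2 (tens (gen G1) [(1, G1); (1, GU); (1, GU2)]) one_plus_SS.

Definition in_I2 (x : ZG2) : Prop :=
  exists r1 r2 r3 r4 : ZG2,
    eqZG2 x (mulZG2 r1 gen1 ++ mulZG2 r2 gen2 ++ mulZG2 r3 gen3 ++ mulZG2 r4 gen4).

(* beta in the coset C = beta0 Gamma_infty  iff  beta0^-1 beta in Gamma_infty *)
Definition in_IH (x : ZG2) : Prop :=
  forall beta0 : PSL2,
    ZP1_zero (flat_map (fun e =>
      if in_Ginfb (gmul (ginv beta0) (snd (snd e))) then scaleP (fst e) (bd (fst (snd e)))
      else []) x).
(* alpha in the coset C = alpha0 Gamma_0 *)
Definition in_IV (x : ZG2) : Prop :=
  forall alpha0 : PSL2,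
    ZP1_zero (flat_map (fun e =>
      if in_G0b (gmul (ginv alpha0) (fst (snd e))) then scaleP (fst e) (bd (snd (snd e)))
      else []) x).
Definition in_ID (x : ZG2) : Prop :=
  forall g : PSL2,
    ZP1_zero (flat_map (fun e =>
      if eqG (gmul (snd (snd e)) (ginv (fst (snd e)))) g then scaleP (fst e) (bd (fst (snd e)))
      else []) x).

(* Main.v *)
(** Write [t(a,b) = (a,b)((1,1) + (S,S))].  Manin's theorem says that the kernel of
    [g |-> [g oo] - [g 0]] on [Z[Gamma]] is generated by [1 + S] and [1 + U + U^2]:
    a continued fraction expansion gives a function [s] of the cusp [g oo] with
    [g = s(g oo) - s(g 0)] modulo these relations.  Applied along the diagonals
    [b a^-1 = const], it shows that [I_D] is generated by [(1,1) + (S,S)] and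
    [(1,1) + (U,U) + (U^2,U^2)], and the latter is [t(1,1) + t(1,U) + t(U,U)]
    minus the second generator of [I_2]; hence every element of [I_D] is, modulo [I_2],
    a combination of the [t(a,b)].  The horizontal boundary of [t(a,b)] is the tensor
    product of the boundaries of [a] and [b], and the other three generators of [I_2] are
    Manin's relations for [t] in each variable, so a combination of the [t(a,b)]
    lying in [I_H] lies in [I_2]. *)
Require Import Defs.
From Stdlib Require Import ZArith List Lia Bool Eqdep_dec Setoid.
Import ListNotations.
Open Scope Z_scope.

(** * The group and its action on the cusps *)

Lemma PSL2_ext g h : pm g = pm h -> g = h.
Proof.
  destruct g as [m d p], h as [m' d' p']; simpl; intros <-.
  f_equal; [apply (UIP_dec Z.eq_dec)|apply (UIP_dec Bool.bool_dec)].
Qed.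

Lemma eqm_eq x y : Defs.eqm x y = true <-> x = y.
Proof.
  destruct x, y; unfold Defs.eqm; simpl. rewrite !andb_true_iff, !Z.eqb_eq.
  split; [intros [[[-> ->] ->] ->]; reflexivity|intros [= -> -> -> ->]; tauto].
Qed.

Lemma eqG_eq g h : eqG g h = true <-> g = h.
Proof.
  unfold eqG; rewrite eqm_eq; split; [apply PSL2_ext|congruence].
Qed.

(** Group identities are checked on matrices up to sign, so the choice of sign made by [nrm] never
    has to be computed. *)
Definition pm_eq (x y : mat) : Prop := x = y \/ x = mneg y.

Lemma mneg_mneg m : mneg (mneg m) = m.
Proof. destruct m; unfold mneg; simpl; f_equal; lia. Qed.

Lemma nrm_pm_eq m : pm_eq (nrm m) m.
Proof. unfold nrm; destruct (posm m); [left|right]; reflexivity. Qed.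

Lemma pm_eq_sym x y : pm_eq x y -> pm_eq y x.
Proof. intros [->| ->]; [left|right]; rewrite ?mneg_mneg; reflexivity. Qed.

Lemma pm_eq_trans x y z : pm_eq x y -> pm_eq y z -> pm_eq x z.
Proof.
  intros [->| ->] [->| ->]; rewrite ?mneg_mneg; unfold pm_eq; auto.
Qed.

Lemma pm_eq_mmul x x' y y' : pm_eq x x' -> pm_eq y y' -> pm_eq (mmul x y) (mmul x' y').
Proof.
  destruct x', y'; intros [->| ->] [->| ->]; unfold pm_eq, mmul, mneg; simpl;
    (left; f_equal; ring) || (right; f_equal; ring).
Qed.

(** The condition [posm] holds for at most one of a matrix and its negative. *)
Lemma PSL2_pm_eq g h : pm_eq (pm g) (pm h) -> g = h.
Proof.
  intros [E|E]; apply PSL2_ext; [exact E|].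
  pose proof (pm_pos g) as P; pose proof (pm_pos h) as Q.
  rewrite E in P. apply posm_iff in P; apply posm_iff in Q.
  unfold mneg in P; simpl in P. lia.
Qed.

Lemma pm_gmul_eq g h : pm_eq (pm (gmul g h)) (mmul (pm g) (pm h)).
Proof. apply nrm_pm_eq. Qed.

Lemma pm_ginv_eq g : pm_eq (pm (ginv g)) (madj (pm g)).
Proof. apply nrm_pm_eq. Qed.

Lemma mmul_assoc x y z : mmul (mmul x y) z = mmul x (mmul y z).
Proof. unfold mmul; simpl; f_equal; ring. Qed.

Lemma gmul_assoc x y z : gmul (gmul x y) z = gmul x (gmul y z).
Proof.
  apply PSL2_pm_eq.
  eapply pm_eq_trans; [apply pm_gmul_eq|].
  eapply pm_eq_trans; [apply pm_eq_mmul; [apply pm_gmul_eq|left; reflexivity]|].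
  rewrite mmul_assoc. apply pm_eq_sym.
  eapply pm_eq_trans; [apply pm_gmul_eq|].
  apply pm_eq_mmul; [left; reflexivity|apply pm_gmul_eq].
Qed.

Lemma gmul_1_l x : gmul G1 x = x.
Proof.
  apply PSL2_pm_eq. eapply pm_eq_trans; [apply pm_gmul_eq|].
  left. destruct (pm x) as [a b c d]; unfold mmul; cbn [pm G1 ma mb mc md]; f_equal; ring.
Qed.

Lemma gmul_1_r x : gmul x G1 = x.
Proof.
  apply PSL2_pm_eq. eapply pm_eq_trans; [apply pm_gmul_eq|].
  left. destruct (pm x) as [a b c d]; unfold mmul; cbn [pm G1 ma mb mc md]; f_equal; ring.
Qed.

Lemma ginv_l x : gmul (ginv x) x = G1.
Proof.
  apply PSL2_pm_eq. eapply pm_eq_trans; [apply pm_gmul_eq|].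
  eapply pm_eq_trans; [apply pm_eq_mmul; [apply pm_ginv_eq|left; reflexivity]|].
  left. pose proof (pm_det x) as D; unfold det in D.
  destruct (pm x) as [a b c d]; unfold mmul, madj; simpl in *; f_equal; lia.
Qed.

Lemma ginv_r x : gmul x (ginv x) = G1.
Proof.
  apply PSL2_pm_eq. eapply pm_eq_trans; [apply pm_gmul_eq|].
  eapply pm_eq_trans; [apply pm_eq_mmul; [left; reflexivity|apply pm_ginv_eq]|].
  left. pose proof (pm_det x) as D; unfold det in D.
  destruct (pm x) as [a b c d]; unfold mmul, madj; simpl in *; f_equal; lia.
Qed.

Lemma gmul_cancel_l g x y : gmul g x = gmul g y -> x = y.
Proof.
  intro H. rewrite <- (gmul_1_l x), <- (gmul_1_l y), <- (ginv_l g), !gmul_assoc.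
  congruence.
Qed.

Lemma GS_GS : gmul GS GS = G1.
Proof. apply PSL2_ext; reflexivity. Qed.

Lemma gmul_S_S g : gmul (gmul g GS) GS = g.
Proof. rewrite gmul_assoc, GS_GS; apply gmul_1_r. Qed.

Lemma GT_eq : GT = gmul GU2 GS.
Proof. apply PSL2_ext; reflexivity. Qed.

Lemma pt_eqb_true x y : pt_eqb x y = true <-> fst x * snd y = fst y * snd x.
Proof. apply Z.eqb_eq. Qed.

Lemma pt_eqb_sym x y : pt_eqb x y = pt_eqb y x.
Proof. apply eq_iff_eq_true; rewrite !pt_eqb_true; lia. Qed.

(** The middle vector must be nonzero because [(0, 0)] is [pt_eqb] to every vector. *)
Lemma pt_eqb_trans x y z : pt_nonzero y ->
  pt_eqb x y = true -> pt_eqb y z = true -> pt_eqb x z = true.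
Proof.
  rewrite !pt_eqb_true; destruct x as [a b], y as [c d], z as [e f];
    unfold pt_nonzero; simpl; intros [N|N] H1 H2.
  - apply (Z.mul_reg_l _ _ c N).
    transitivity (a * (c * f)); [ring|]. rewrite H2.
    transitivity (e * (a * d)); [ring|]. rewrite H1; ring.
  - apply (Z.mul_reg_l _ _ d N).
    transitivity (f * (a * d)); [ring|]. rewrite H1.
    transitivity (b * (c * f)); [ring|]. rewrite H2; ring.
Qed.

Lemma act_nonzero g x : pt_nonzero x -> pt_nonzero (act g x).
Proof.
  pose proof (pm_det g) as D; unfold det in D.
  destruct x as [p q]; unfold pt_nonzero, act; simpl.
  destruct (pm g) as [a b c d]; simpl in *; intro N.
  assert (d * (a * p + b * q) - b * (c * p + d * q) = p) by
    (replace p with (1 * p) at 3 by ring; rewrite <- D; ring).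
  assert (a * (c * p + d * q) - c * (a * p + b * q) = q) by
    (replace q with (1 * q) at 3 by ring; rewrite <- D; ring).
  destruct (Z.eq_dec (a * p + b * q) 0) as [E|]; [|auto].
  destruct (Z.eq_dec (c * p + d * q) 0) as [E'|]; [|auto].
  rewrite E, E' in *; lia.
Qed.

Lemma act_gmul g h x : act (gmul g h) x = act g (act h x) \/
  act (gmul g h) x = (- fst (act g (act h x)), - snd (act g (act h x))).
Proof.
  unfold act. destruct (pm_gmul_eq g h) as [->| ->]; [left|right];
    unfold mmul, mneg; simpl; f_equal; ring.
Qed.

Lemma pt_eqb_act g x y : pt_eqb (act g x) (act g y) = pt_eqb x y.
Proof.
  apply eq_iff_eq_true; rewrite !pt_eqb_true.
  pose proof (pm_det g) as D; unfold det in D. unfold act; simpl.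
  destruct x as [p q], y as [p' q'], (pm g) as [a b c d]; simpl in *.
  assert ((a * p + b * q) * (c * p' + d * q') - (a * p' + b * q') * (c * p + d * q)
     = p * q' - p' * q) by
   (replace (p * q' - p' * q) with (1 * (p * q' - p' * q)) by ring; rewrite <- D; ring).
  lia.
Qed.

Lemma pt_eqb_act_gmul g h x y : pt_eqb (act (gmul g h) x) y = pt_eqb (act g (act h x)) y.
Proof.
  apply eq_iff_eq_true; rewrite !pt_eqb_true.
  destruct (act_gmul g h x) as [->| ->]; simpl; lia.
Qed.

Lemma pt_eqb_act_1 x y : pt_eqb (act G1 x) y = pt_eqb x y.
Proof. f_equal. unfold act; destruct x; cbn [pm G1 ma mb mc md fst snd]; f_equal; ring. Qed.

Lemma pt_eqb_act_l g x y : pt_eqb (act g x) y = pt_eqb x (act (ginv g) y).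
Proof.
  rewrite <- (pt_eqb_act g x), (pt_eqb_sym _ (act g (act _ y))), <- pt_eqb_act_gmul, ginv_r,
    pt_eqb_act_1, pt_eqb_sym. reflexivity.
Qed.

Lemma pt_eqb_gmul_l g h x y : pt_eqb (act (gmul g h) x) y = pt_eqb (act h x) (act (ginv g) y).
Proof. rewrite pt_eqb_act_gmul; apply pt_eqb_act_l. Qed.

Lemma pt_eqb_gmul_both g h h' x y :
  pt_eqb (act (gmul g h) x) (act (gmul g h') y) = pt_eqb (act h x) (act h' y).
Proof.
  rewrite pt_eqb_act_gmul, pt_eqb_sym, pt_eqb_act_gmul, pt_eqb_sym; apply pt_eqb_act.
Qed.

(** Gamma_oo is the stabilizer of oo, so its cosets correspond to cusps and the conditions of
    [in_IH] can be read at cusps. *)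
Lemma in_Ginfb_pt g h : in_Ginfb (gmul (ginv g) h) = pt_eqb (act h pinf) (act g pinf).
Proof.
  transitivity (pt_eqb (act (gmul (ginv g) h) pinf) pinf).
  - apply eq_iff_eq_true; rewrite pt_eqb_true; unfold in_Ginfb, act, pinf; cbn [fst snd].
    rewrite Z.eqb_eq; lia.
  - rewrite pt_eqb_act_gmul, <- (pt_eqb_act g), <- pt_eqb_act_gmul, ginv_r, pt_eqb_act_1.
    reflexivity.
Qed.

Lemma in_G0b_pt g h : in_G0b (gmul (ginv g) h) = pt_eqb (act h pzero) (act g pzero).
Proof.
  transitivity (pt_eqb (act (gmul (ginv g) h) pzero) pzero).
  - apply eq_iff_eq_true; rewrite pt_eqb_true; unfold in_G0b, act, pzero; cbn [fst snd].
    rewrite Z.eqb_eq; lia.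
  - rewrite pt_eqb_act_gmul, <- (pt_eqb_act g), <- pt_eqb_act_gmul, ginv_r, pt_eqb_act_1.
    reflexivity.
Qed.

(** * Linear functionals on formal sums *)

Definition lin {K} (f : K -> Z) (L : list (Z * K)) : Z :=
  fold_right (fun e acc => fst e * f (snd e) + acc) 0 L.

Lemma lin_cons {K} (f : K -> Z) e L : lin f (e :: L) = fst e * f (snd e) + lin f L.
Proof. reflexivity. Qed.

Lemma lin_app {K} (f : K -> Z) L L' : lin f (L ++ L') = lin f L + lin f L'.
Proof. induction L as [|e L IH]; simpl; [|rewrite IH]; ring. Qed.

Lemma lin_neg {K} (f : K -> Z) L :
  lin f (map (fun e => (- fst e, snd e)) L) = - lin f L.
Proof. induction L as [|e L IH]; simpl; [|rewrite IH]; ring. Qed.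

Lemma lin_ext {K} (f g : K -> Z) L : (forall k, f k = g k) -> lin f L = lin g L.
Proof. intro H; induction L as [|e L IH]; simpl; [|rewrite IH, H]; ring. Qed.

Lemma lin_add {K} (f g : K -> Z) L : lin (fun k => f k + g k) L = lin f L + lin g L.
Proof. induction L as [|e L IH]; simpl; [|rewrite IH]; ring. Qed.

Lemma lin_sub {K} (f g : K -> Z) L : lin (fun k => f k - g k) L = lin f L - lin g L.
Proof. induction L as [|e L IH]; simpl; [|rewrite IH]; ring. Qed.

Lemma lin_scale {K} c (f : K -> Z) L : lin (fun k => c * f k) L = c * lin f L.
Proof. induction L as [|e L IH]; simpl; [|rewrite IH]; ring. Qed.

Lemma lin_flat_map {K K' X} (f : K -> Z) (u : K' -> X -> K) (h : K' -> list (Z * X)) L :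
  lin f (flat_map (fun e => map (fun d => (fst e * fst d, u (snd e) (snd d))) (h (snd e))) L)
  = lin (fun k => lin (fun d => f (u k d)) (h k)) L.
Proof.
  induction L as [|e L IH]; simpl; [reflexivity|].
  rewrite lin_app, IH; f_equal.
  induction (h (snd e)) as [|d D IHD]; simpl; [|rewrite IHD]; ring.
Qed.

Definition ind (b : bool) : Z := if b then 1 else 0.

Section Support.
Context {K : Type} (E : K -> K -> bool).
Hypothesis E_refl : forall x, E x x = true.
Hypothesis E_sym : forall x y, E x y = true -> E y x = true.
Hypothesis E_trans : forall x y z, E x y = true -> E y z = true -> E x z = true.

(** Induction on the representatives [ks]: subtracting [f k] times the indicator of the class of
    [k], which sums to 0 over [L], leaves a function that is still constant on classes and vanishes
    on that class. *)
Lemma lin_support (L : list (Z * K)) (ks : list K) (f : K -> Z) :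
  (forall k, lin (fun x => ind (E x k)) L = 0) ->
  (forall x y, E x y = true -> f x = f y) ->
  (forall e, In e L -> f (snd e) = 0 \/ exists k, In k ks /\ E (snd e) k = true) ->
  lin f L = 0.
Proof.
  intro H0; revert f; induction ks as [|k ks IH]; intros f Hf Hs.
  - assert (Z0 : forall e, In e L -> f (snd e) = 0)
      by (intros e He; destruct (Hs e He) as [|[k [[] _]]]; assumption).
    clear -Z0; induction L as [|e L IH]; simpl; [reflexivity|].
    rewrite IH, Z0; [ring|left; reflexivity|intros; apply Z0; right; assumption].
  - rewrite (lin_ext _ (fun x => (if E x k then 0 else f x) + f k * ind (E x k))).
    2:{ intro x; destruct (E x k) eqn:Ex; unfold ind; [rewrite (Hf _ _ Ex)|]; ring. }
    rewrite lin_add, lin_scale, H0, IH; [ring| |].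
    + intros x y Exy.
      destruct (E x k) eqn:Ex, (E y k) eqn:Ey; try apply Hf; try assumption; try reflexivity.
      * rewrite (E_trans y x k) in Ey; [discriminate|apply E_sym; assumption|assumption].
      * rewrite (E_trans x y k) in Ex; [discriminate|assumption|assumption].
    + intros e He. destruct (E (snd e) k) eqn:Ek; [left; reflexivity|].
      destruct (Hs e He) as [|[k' [[<-|Hk'] Ek']]]; [left; assumption|congruence|].
      right; exists k'; split; assumption.
Qed.

Lemma lin_zero (L : list (Z * K)) (f : K -> Z) :
  (forall k, lin (fun x => ind (E x k)) L = 0) ->
  (forall x y, E x y = true -> f x = f y) -> lin f L = 0.
Proof.
  intros H0 Hf. apply (lin_support L (map snd L)); [assumption..|].
  intros e He; right; exists (snd e); split; [apply in_map; assumption|apply E_refl].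
Qed.

(** In the applications [h x] is the boundary of [x] and classes are cusps: if the total boundary of
    [L] vanishes at each cusp, every function of cusps sums to 0 over it. *)
Lemma lin_bind_zero {X} (h : X -> list (Z * K)) (L : list (Z * X)) (f : K -> Z) :
  (forall k, lin (fun x => lin (fun y => ind (E y k)) (h x)) L = 0) ->
  (forall x y, E x y = true -> f x = f y) ->
  lin (fun x => lin f (h x)) L = 0.
Proof.
  intros H0 Hf.
  etransitivity; [symmetry; exact (lin_flat_map f (fun _ d => d) h L)|].
  apply lin_zero; [|assumption].
  intro k; etransitivity;
    [exact (lin_flat_map (fun y => ind (E y k)) (fun _ d => d) h L)|apply H0].
Qed.
End Support.

(** * The group ring of Gamma^2 *)

Notation G2 := (PSL2 * PSL2)%type.
Definition eqG2 (p q : G2) : bool := (eqG (fst p) (fst q) && eqG (snd p) (snd q))%bool.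
Definition mul2 (p q : G2) : G2 := (gmul (fst p) (fst q), gmul (snd p) (snd q)).
Definition delta (p g : G2) : Z := ind (eqG2 p g).

Lemma eqG2_eq p q : eqG2 p q = true <-> p = q.
Proof.
  destruct p, q; unfold eqG2; simpl. rewrite andb_true_iff, !eqG_eq.
  split; [intros [-> ->]; reflexivity|intros [= -> ->]; auto].
Qed.

Lemma mul2_assoc p q r : mul2 (mul2 p q) r = mul2 p (mul2 q r).
Proof. unfold mul2; simpl; rewrite !gmul_assoc; reflexivity. Qed.

Lemma coeff2_lin x g : coeff2 x g = lin (fun p => delta p g) x.
Proof.
  induction x as [|e x IH]; simpl; [reflexivity|].
  rewrite IH; unfold delta at 2, eqG2, ind. destruct (_ && _)%bool; ring.
Qed.

Lemma lin_eqZG2 f x y : eqZG2 x y -> lin f x = lin f y.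
Proof.
  intro H.
  assert (Q : lin f (x ++ negZG2 y) = 0).
  { apply (lin_zero eqG2).
    - intro; apply eqG2_eq; reflexivity.
    - intros ? ?; rewrite !eqG2_eq; congruence.
    - intros ? ? ?; rewrite !eqG2_eq; congruence.
    - intro g. rewrite lin_app. unfold negZG2; rewrite lin_neg.
      specialize (H g). rewrite !coeff2_lin in H. unfold delta in H. rewrite H; ring.
    - intros ? ?; rewrite eqG2_eq; congruence. }
  rewrite lin_app in Q; unfold negZG2 in Q; rewrite lin_neg in Q; lia.
Qed.

Lemma lin_mulZG2 f x y : lin f (mulZG2 x y) = lin (fun p => lin (fun q => f (mul2 p q)) y) x.
Proof. exact (lin_flat_map f mul2 (fun _ => y) x). Qed.

(** Coefficient function of the left translate of [y] by [p]. *)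
Definition tr (y : ZG2) (p g : G2) : Z := lin (fun q => delta (mul2 p q) g) y.

Lemma coeff2_mul r y g : coeff2 (mulZG2 r y) g = lin (fun p => tr y p g) r.
Proof. rewrite coeff2_lin; apply lin_mulZG2. Qed.

Lemma tr_mul y z p g : tr (mulZG2 y z) p g = lin (fun q => tr z (mul2 p q) g) y.
Proof.
  unfold tr; rewrite lin_mulZG2. apply lin_ext; intro q; apply lin_ext; intro r.
  rewrite mul2_assoc; reflexivity.
Qed.

(** * The boundary conditions as linear functionals *)

Definition pind (g : PSL2) (v : pt) : Z :=
  ind (pt_eqb (act g pinf) v) - ind (pt_eqb (act g pzero) v).
(** Coefficient at [v] of the horizontal boundary lying over the cusp [w]; [vfun] and [dfun] are the
    vertical and diagonal analogues. *)
Definition hfun (v w : pt) (p : G2) : Z := ind (pt_eqb (act (snd p) pinf) w) * pind (fst p) v.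
Definition vfun (v w : pt) (p : G2) : Z := ind (pt_eqb (act (fst p) pzero) w) * pind (snd p) v.
Definition dfun (g : PSL2) (v : pt) (p : G2) : Z :=
  ind (eqG (gmul (snd p) (ginv (fst p))) g) * pind (fst p) v.

Lemma coeffP_app s t v : coeffP (s ++ t) v = coeffP s v + coeffP t v.
Proof. induction s as [|e s IH]; simpl; [|rewrite IH]; ring. Qed.

Lemma coeffP_bd (B : G2 -> bool) (A : G2 -> PSL2) (x : ZG2) (v : pt) :
  coeffP (flat_map (fun e => if B (snd e) then scaleP (fst e) (bd (A (snd e))) else []) x) v
  = lin (fun p => ind (B p) * pind (A p) v) x.
Proof.
  induction x as [|e x IH]; [reflexivity|].
  rewrite lin_cons; cbn [flat_map]. rewrite coeffP_app, IH. f_equal.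
  destruct (B (snd e)); unfold pind, ind;
    cbn [scaleP bd map coeffP fold_right fst snd]; repeat case (pt_eqb _ v); ring.
Qed.

Lemma in_IH_lin x : in_IH x <->
  forall b v, pt_nonzero v -> lin (hfun v (act b pinf)) x = 0.
Proof.
  unfold in_IH, ZP1_zero.
  assert (Q : forall b v,
    coeffP (flat_map (fun e => if in_Ginfb (gmul (ginv b) (snd (snd e)))
      then scaleP (fst e) (bd (fst (snd e))) else []) x) v = lin (hfun v (act b pinf)) x).
  { intros b v. etransitivity; [exact (coeffP_bd (fun p => in_Ginfb (gmul (ginv b) (snd p))) fst x v)|].
    apply lin_ext; intro p; unfold hfun; rewrite in_Ginfb_pt; reflexivity. }
  split; intros H b v N; [rewrite <- Q|rewrite Q]; apply H; exact N.
Qed.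

Lemma in_IV_lin x : in_IV x <->
  forall a v, pt_nonzero v -> lin (vfun v (act a pzero)) x = 0.
Proof.
  unfold in_IV, ZP1_zero.
  assert (Q : forall a v,
    coeffP (flat_map (fun e => if in_G0b (gmul (ginv a) (fst (snd e)))
      then scaleP (fst e) (bd (snd (snd e))) else []) x) v = lin (vfun v (act a pzero)) x).
  { intros a v. etransitivity; [exact (coeffP_bd (fun p => in_G0b (gmul (ginv a) (fst p))) snd x v)|].
    apply lin_ext; intro p; unfold vfun; rewrite in_G0b_pt; reflexivity. }
  split; intros H b v N; [rewrite <- Q|rewrite Q]; apply H; exact N.
Qed.

Lemma in_ID_lin x : in_ID x <-> forall g v, pt_nonzero v -> lin (dfun g v) x = 0.
Proof.
  unfold in_ID, ZP1_zero.
  assert (Q : forall g v,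
    coeffP (flat_map (fun e => if eqG (gmul (snd (snd e)) (ginv (fst (snd e)))) g
      then scaleP (fst e) (bd (fst (snd e))) else []) x) v = lin (dfun g v) x).
  { intros g v. exact (coeffP_bd (fun p => eqG (gmul (snd p) (ginv (fst p))) g) fst x v). }
  split; intros H b v N; [rewrite <- Q|rewrite Q]; apply H; exact N.
Qed.

Lemma pind_gmul g h v : pind (gmul g h) v = pind h (act (ginv g) v).
Proof. unfold pind; rewrite !pt_eqb_gmul_l; reflexivity. Qed.

(** Equivariance: translation by [p] only moves the cusps, so a generator killed for all cusps has
    all its translates killed. *)
Lemma hfun_mul2 v w p q :
  hfun v w (mul2 p q) = hfun (act (ginv (fst p)) v) (act (ginv (snd p)) w) q.
Proof. unfold hfun, mul2; cbn [fst snd]; rewrite pind_gmul, pt_eqb_gmul_l; reflexivity. Qed.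

Lemma vfun_mul2 v w p q :
  vfun v w (mul2 p q) = vfun (act (ginv (snd p)) v) (act (ginv (fst p)) w) q.
Proof. unfold vfun, mul2; cbn [fst snd]; rewrite pind_gmul, pt_eqb_gmul_l; reflexivity. Qed.

Lemma ginv_gmul g h : ginv (gmul g h) = gmul (ginv h) (ginv g).
Proof.
  apply (gmul_cancel_l (gmul g h)).
  rewrite ginv_r, gmul_assoc, <- (gmul_assoc h), ginv_r, gmul_1_l, ginv_r; reflexivity.
Qed.

(** Translation by [p] sends the diagonal b a^-1 = h to the one of index p2 h p1^-1, where p = (p1,
    p2). *)
Lemma dfun_mul2 g v p q :
  dfun g v (mul2 p q) =
  dfun (gmul (gmul (ginv (snd p)) g) (fst p)) (act (ginv (fst p)) v) q.
Proof.
  unfold dfun, mul2; cbn [fst snd]; rewrite pind_gmul. f_equal. f_equal.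
  apply eq_iff_eq_true; rewrite !eqG_eq, ginv_gmul. split.
  - intros <-.
    rewrite <- !gmul_assoc, ginv_l, gmul_1_l, !gmul_assoc, ginv_l, gmul_1_r; reflexivity.
  - intro H.
    rewrite (gmul_assoc (snd p)), <- (gmul_assoc (snd q)), H.
    rewrite <- !gmul_assoc, ginv_r, gmul_1_l, !gmul_assoc, ginv_r, gmul_1_r; reflexivity.
Qed.

(** * Inclusion of I_2 in I_H, I_V and I_D *)

Lemma pt_eqb_opp_l p q v : pt_eqb (- p, - q) v = pt_eqb (p, q) v.
Proof. apply eq_iff_eq_true; rewrite !pt_eqb_true; cbn [fst snd]; lia. Qed.

(** On the generators every cusp that occurs is oo, 0 or 1; once the signs of the vectors agree, the
    claim is a polynomial identity in indicators. *)
Ltac eval_gens :=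
  cbv [lin fold_right flat_map map app gen1 gen2 gen3 gen4 one_plus_SS mulZG2 tens gen
       negZG2 fst snd hfun vfun dfun pind eqG];
  repeat match goal with
  | |- context [act ?g ?x] => let r := eval vm_compute in (act g x) in change (act g x) with r
  | |- context [pm (gmul ?g ?h)] =>
      let r := eval vm_compute in (pm (gmul g h)) in change (pm (gmul g h)) with r
  end;
  rewrite ?(pt_eqb_opp_l 1 0 : forall v, pt_eqb (-1, 0) v = _),
    ?(pt_eqb_opp_l 0 1 : forall v, pt_eqb (0, -1) v = _),
    ?(pt_eqb_opp_l 1 1 : forall v, pt_eqb (-1, -1) v = _);
  ring.

Lemma lin_in_I2 (f : G2 -> Z) (x : ZG2) :
  (forall p y, In y [gen1; gen2; gen3; gen4] -> lin (fun q => f (mul2 p q)) y = 0) ->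
  in_I2 x -> lin f x = 0.
Proof.
  intros H (r1 & r2 & r3 & r4 & E). rewrite (lin_eqZG2 _ _ _ E), !lin_app, !lin_mulZG2.
  assert (Q : forall r y, In y [gen1; gen2; gen3; gen4] ->
    lin (fun p => lin (fun q => f (mul2 p q)) y) r = 0).
  { intros r y Hy. rewrite (lin_ext _ (fun _ => 0 * 0)), lin_scale; [reflexivity|].
    intro p; apply H, Hy. }
  rewrite !Q; simpl; tauto.
Qed.

Lemma I2_sub_IH x : in_I2 x -> in_IH x.
Proof.
  intro H; apply in_IH_lin; intros b v _; revert H; apply lin_in_I2.
  intros p y Hy. rewrite (lin_ext _ _ _ (hfun_mul2 _ _ p)).
  generalize (act (ginv (fst p)) v) (act (ginv (snd p)) (act b pinf)); intros v' w'.
  destruct Hy as [<-|[<-|[<-|[<-|[]]]]]; eval_gens.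
Qed.

Lemma I2_sub_IV x : in_I2 x -> in_IV x.
Proof.
  intro H; apply in_IV_lin; intros b v _; revert H; apply lin_in_I2.
  intros p y Hy. rewrite (lin_ext _ _ _ (vfun_mul2 _ _ p)).
  generalize (act (ginv (snd p)) v) (act (ginv (fst p)) (act b pzero)); intros v' w'.
  destruct Hy as [<-|[<-|[<-|[<-|[]]]]]; eval_gens.
Qed.

Lemma I2_sub_ID x : in_I2 x -> in_ID x.
Proof.
  intro H; apply in_ID_lin; intros b v _; revert H; apply lin_in_I2.
  intros p y Hy. rewrite (lin_ext _ _ _ (dfun_mul2 _ _ p)).
  generalize (gmul (gmul (ginv (snd p)) b) (fst p)) (act (ginv (fst p)) v); intros g w.
  destruct Hy as [<-|[<-|[<-|[<-|[]]]]]; eval_gens.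
Qed.

(** * Manin's theorem *)

(** [P f] is read as: [f] is 0 modulo the subgroup [P]. Closure under pointwise equality lets
    functions be rewritten pointwise. *)
Record subgroup (P : (G2 -> Z) -> Prop) : Prop := {
  sub_ext : forall f g, (forall p, f p = g p) -> P f -> P g;
  sub_zero : P (fun _ => 0);
  sub_sub : forall f g, P f -> P g -> P (fun p => f p - g p) }.

Section Subgroup.
Context (P : (G2 -> Z) -> Prop) (HP : subgroup P).

Lemma sub_opp f : P f -> P (fun p => - f p).
Proof.
  intro H. eapply (sub_ext P HP); [|apply (sub_sub P HP _ _ (sub_zero P HP) H)].
  intro p; simpl; ring.
Qed.

Lemma sub_add f g : P f -> P g -> P (fun p => f p + g p).
Proof.
  intros Hf Hg. eapply (sub_ext P HP); [|apply (sub_sub P HP _ _ Hf (sub_opp _ Hg))].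
  intro p; simpl; ring.
Qed.

Lemma sub_scale n f : P f -> P (fun p => n * f p).
Proof.
  intro Hf. revert n.
  assert (Q : forall k, P (fun p => Z.of_nat k * f p)).
  { induction k as [|k IH].
    - eapply (sub_ext P HP); [|apply (sub_zero P HP)]. intro p; simpl; ring.
    - eapply (sub_ext P HP); [|apply (sub_add _ _ IH Hf)]. intro p; cbv beta; rewrite Nat2Z.inj_succ; ring. }
  intro n; destruct (Z_le_gt_dec 0 n).
  - rewrite <- (Z2Nat.id n) by lia; apply Q.
  - eapply (sub_ext P HP); [|apply (sub_opp _ (Q (Z.to_nat (- n))))].
    intro p; cbv beta; rewrite Z2Nat.id by lia; ring.
Qed.

Lemma sub_lin {K} (F : K -> G2 -> Z) L : (forall k, P (F k)) -> P (fun p => lin (fun k => F k p) L).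
Proof.
  intro H; induction L as [|e L IH]; simpl; [apply (sub_zero P HP)|].
  apply sub_add; [apply sub_scale, H|exact IH].
Qed.
End Subgroup.

(* [red g] is the matrix in [g Gamma_oo] with [0 <= d < c] (for [c > 0]), so [red g * S]
   has a smaller [c]: the recursion of [cf] is a minus continued fraction expansion
   of the cusp [g oo], summing [F] over the edges of a Farey path from [oo] to it. *)
Definition red (g : PSL2) : PSL2 := gmul g (gpow GT (- (md (pm g) / mc (pm g)))).

Fixpoint cfn (F : PSL2 -> Z) (n : nat) (g : PSL2) : Z :=
  match n with
  | O => 0
  | S n => if mc (pm g) =? 0 then 0 else F (red g) + cfn F n (gmul (red g) GS)
  end.
Definition cf (F : PSL2 -> Z) (g : PSL2) : Z := cfn F (Z.to_nat (mc (pm g))) g.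

Lemma mc_nonneg g : 0 <= mc (pm g).
Proof. pose proof (pm_pos g) as H; apply posm_iff in H; lia. Qed.

Lemma nrm_pos m : 0 < mc m -> nrm m = m.
Proof. intro H; unfold nrm; rewrite (proj2 (posm_iff m)); auto. Qed.

Lemma pm_red g : 0 < mc (pm g) ->
  pm (red g) = M (ma (pm g)) (mb (pm g) - ma (pm g) * (md (pm g) / mc (pm g)))
                 (mc (pm g)) (md (pm g) mod mc (pm g)).
Proof.
  intro H. unfold red. rewrite pm_gmul, pm_gpow_T.
  rewrite nrm_pos by (unfold mmul; cbn [ma mb mc md]; lia).
  unfold mmul; cbn [ma mb mc md]. rewrite Z.mod_eq by lia.
  f_equal; ring.
Qed.

(** One Euclidean division on the bottom row; [nrm] can change the sign only when the remainder is
    0. *)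
Lemma mc_red_S g : 0 < mc (pm g) -> mc (pm (gmul (red g) GS)) = md (pm g) mod mc (pm g).
Proof.
  intro H. rewrite pm_gmul, pm_red by exact H.
  pose proof (Z.mod_pos_bound (md (pm g)) _ H) as B.
  set (m := mmul _ _).
  assert (E : mc m = md (pm g) mod mc (pm g))
    by (unfold m, mmul; cbn [pm GS ma mb mc md]; ring).
  unfold nrm; destruct (posm m) eqn:Q; [exact E|].
  destruct (Z.eq_dec (mc m) 0) as [E0|N0].
  - unfold mneg; cbn [mc]; lia.
  - rewrite (proj2 (posm_iff m)) in Q; [discriminate|left; lia].
Qed.

(** The entry c drops strictly at each step, so fuel at least c always reaches c = 0. *)
Lemma cfn_fuel F n m g : mc (pm g) <= Z.of_nat n -> mc (pm g) <= Z.of_nat m ->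
  cfn F n g = cfn F m g.
Proof.
  revert m g; induction n as [|n IH]; intros m g Hn Hm;
    pose proof (mc_nonneg g) as N.
  - destruct m; simpl; [reflexivity|]. replace (mc (pm g)) with 0 by lia; reflexivity.
  - destruct m as [|m]; simpl; destruct (Z.eqb_spec (mc (pm g)) 0); try lia.
    f_equal. pose proof (Z.mod_pos_bound (md (pm g)) (mc (pm g)) ltac:(lia)).
    apply IH; rewrite mc_red_S; lia.
Qed.

Lemma cf_zero F g : mc (pm g) = 0 -> cf F g = 0.
Proof. intro H; unfold cf; rewrite H; reflexivity. Qed.

Lemma cf_step F g : 0 < mc (pm g) -> cf F g = F (red g) + cf F (gmul (red g) GS).
Proof.
  intro H. unfold cf at 1. destruct (Z.to_nat (mc (pm g))) as [|n] eqn:En; [lia|].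
  simpl. destruct (Z.eqb_spec (mc (pm g)) 0); [lia|]. f_equal.
  pose proof (Z.mod_pos_bound (md (pm g)) (mc (pm g)) H).
  apply cfn_fuel; rewrite mc_red_S; lia.
Qed.

Lemma red_id g : 0 <= md (pm g) < mc (pm g) -> red g = g.
Proof.
  intro H; unfold red; rewrite Z.div_small by exact H. apply gmul_1_r.
Qed.

Lemma same_pt g h : pt_eqb (act g pinf) (act h pinf) = true ->
  mc (pm g) = mc (pm h) /\ (0 < mc (pm g) -> ma (pm g) = ma (pm h)).
Proof.
  rewrite pt_eqb_true; unfold act, pinf; cbn [fst snd].
  pose proof (pm_det g) as D; pose proof (pm_det h) as D'; unfold det in *.
  pose proof (mc_nonneg g); pose proof (mc_nonneg h).
  destruct (pm g) as [a b c d], (pm h) as [a' b' c' d']; cbn [ma mb mc md] in *; intro E.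
  assert (E1 : a * c' = a' * c) by lia.
  (* both first columns are primitive, so [k] is a unit *)
  set (k := a' * d - b * c').
  assert (A : a' = k * a).
  { unfold k. transitivity (a' * (a * d - b * c)); [rewrite D; ring|].
    transitivity (a' * d * a - b * (a' * c)); [ring|]. rewrite <- E1; ring. }
  assert (C : c' = k * c).
  { unfold k. transitivity (c' * (a * d - b * c)); [rewrite D; ring|].
    transitivity (d * (a * c') - b * c * c'); [ring|]. rewrite E1; ring. }
  assert (K : k * (a * d' - b' * c) = 1)
    by (rewrite <- D', A, C; ring).
  destruct (Z.eq_mul_1 _ _ K) as [K1|K1]; rewrite K1 in *; lia.
Qed.

(** Elements with the same cusp differ by a power of T on the right, and the condition 0 <= d < c
    selects one of them. *)
Lemma red_pt g h : 0 < mc (pm g) -> pt_eqb (act g pinf) (act h pinf) = true -> red g = red h.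
Proof.
  intros H E. destruct (same_pt g h E) as [C A]; specialize (A H).
  assert (H' : 0 < mc (pm h)) by lia.
  pose proof (pm_det (red g)) as D; pose proof (pm_det (red h)) as D'.
  pose proof (Z.mod_pos_bound (md (pm g)) _ H).
  pose proof (Z.mod_pos_bound (md (pm h)) _ H').
  apply PSL2_ext. rewrite (pm_red g), (pm_red h) in * by assumption.
  unfold det in *; cbn [ma mb mc md] in *. rewrite <- C, <- A in *.
  set (a := ma (pm g)) in *; set (c := mc (pm g)) in *.
  set (r := md (pm g) mod c) in *; set (r' := md (pm h) mod c) in *.
  set (b := mb (pm g) - _) in *; set (b' := mb (pm h) - _) in *.
  (* Eliminating a between the two determinant equations makes r - r' a multiple of c, while both
     lie in [0, c). *)
  assert (R : r = r').
  { assert (X : r - r' = c * (b * r' - b' * r)).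
    { transitivity ((a * r' - b' * c) * r - (a * r - b * c) * r'); [rewrite D, D'|]; ring. }
    generalize dependent (b * r' - b' * r); intros k X.
    destruct (Z.lt_trichotomy k 0) as [|[->|]]; nia. }
  rewrite R in *; f_equal.
  apply (Z.mul_reg_r _ _ c); lia.
Qed.

(** After one step the recursion sees only [red g], so [cf F] is a function s of the cusp g oo. *)
Lemma cf_pt F g h : pt_eqb (act g pinf) (act h pinf) = true -> cf F g = cf F h.
Proof.
  intro E. pose proof (mc_nonneg g). destruct (same_pt g h E) as [C _].
  destruct (Z.eq_dec (mc (pm g)) 0).
  - rewrite !cf_zero; [reflexivity|lia|lia].
  - rewrite (cf_step F g), (cf_step F h), (red_pt g h) by (assumption || lia). reflexivity.
Qed.

Lemma cf_add F F' g : cf (fun h => F h + F' h) g = cf F g + cf F' g.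
Proof.
  unfold cf; generalize (Z.to_nat (mc (pm g))) as n; intro n; revert g.
  induction n as [|n IH]; intro g; simpl; [reflexivity|].
  destruct (_ =? _); [reflexivity|]. rewrite IH; ring.
Qed.

Lemma cf_sub F F' g : cf (fun h => F h - F' h) g = cf F g - cf F' g.
Proof.
  unfold cf; generalize (Z.to_nat (mc (pm g))) as n; intro n; revert g.
  induction n as [|n IH]; intro g; simpl; [reflexivity|].
  destruct (_ =? _); [reflexivity|]. rewrite IH; ring.
Qed.

Lemma cf_ext F F' g : (forall h, F h = F' h) -> cf F g = cf F' g.
Proof.
  intro H; unfold cf; generalize (Z.to_nat (mc (pm g))) as n; intro n; revert g.
  induction n as [|n IH]; intro g; simpl; [reflexivity|].
  rewrite IH, H; reflexivity.
Qed.

Lemma cf_subgroup P (HP : subgroup P) (F : PSL2 -> G2 -> Z) g :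
  (forall h, P (F h)) -> P (fun p => cf (fun h => F h p) g).
Proof.
  intro H; unfold cf; generalize (Z.to_nat (mc (pm g))) as n; intro n; revert g.
  induction n as [|n IH]; intro g; simpl; [apply (sub_zero P HP)|].
  destruct (_ =? _); [apply (sub_zero P HP)|].
  apply (sub_add P HP); [apply H|apply IH].
Qed.

(** Since S oo = 0, this is s(g oo) - s(g 0). *)
Definition cfd (F : PSL2 -> Z) (g : PSL2) : Z := cf F g - cf F (gmul g GS).

Lemma cfd_add F F' g : cfd (fun h => F h + F' h) g = cfd F g + cfd F' g.
Proof. unfold cfd; rewrite !cf_add; ring. Qed.

Lemma cfd_ext F F' g : (forall h, F h = F' h) -> cfd F g = cfd F' g.
Proof. intro H; unfold cfd; rewrite !(cf_ext F F') by exact H; reflexivity. Qed.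

Lemma cfd_subgroup P (HP : subgroup P) (F : PSL2 -> G2 -> Z) g :
  (forall h, P (F h)) -> P (fun p => cfd (fun h => F h p) g).
Proof. intro H; unfold cfd; apply (sub_sub P HP); apply cf_subgroup; assumption. Qed.

Section Manin.
Context (P : (G2 -> Z) -> Prop) (HP : subgroup P) (F : PSL2 -> G2 -> Z).
Hypothesis F_S : forall g, P (fun p => F g p + F (gmul g GS) p).
Hypothesis F_U : forall g, P (fun p => F g p + F (gmul g GU) p + F (gmul g GU2) p).

(** A Farey triangle: the edge from g oo to g 0 is the edge gT from g oo to g 1 followed by the edge
    gUS from g 1 to g 0. *)
Lemma F_triangle g : P (fun p => F g p - F (gmul g GT) p - F (gmul g GUS) p).
Proof.
  eapply (sub_ext P HP);
    [|apply (sub_sub P HP _ _ (F_U g)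
        (sub_add P HP _ _ (F_S (gmul g GU)) (F_S (gmul g GU2))))].
  intro p; cbv beta. rewrite !gmul_assoc, GT_eq. unfold GUS; ring.
Qed.

Definition manin (g : PSL2) : Prop := P (fun p => F g p - cfd (fun h => F h p) g).

Lemma manin_flip g : manin (gmul g GS) -> manin g.
Proof.
  unfold manin; intro H. eapply (sub_ext P HP); [|apply (sub_sub P HP _ _ (F_S g) H)].
  intro p; unfold cfd; cbv beta. rewrite gmul_S_S; ring.
Qed.

(** Here [red g] is [g], so the first step of the expansion splits off exactly [F g]. *)
Lemma manin_red g : 0 <= md (pm g) < mc (pm g) -> manin g.
Proof.
  intro H; unfold manin. eapply (sub_ext P HP); [|apply (sub_zero P HP)].
  intro p; unfold cfd. rewrite cf_step, red_id by lia. ring.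
Qed.

(** In the triangle of [g] the edge gT is reduced and starts at the same cusp g oo, so the expansion
    handles it; the hypothesis handles gUS, and the values s(g 1) cancel. *)
Lemma manin_step g : - mc (pm g) <= md (pm g) < 0 -> manin (gmul g GUS) -> manin g.
Proof.
  unfold manin; intros H IH.
  eapply (sub_ext P HP); [|apply (sub_add P HP _ _ (F_triangle g) IH)].
  intro p; unfold cfd; cbv beta. set (F' := fun h => F h p).
  change (F g p) with (F' g); change (F (gmul g GT) p) with (F' (gmul g GT));
    change (F (gmul g GUS) p) with (F' (gmul g GUS)).
  assert (ET : pm (gmul g GT) = M (ma (pm g)) (ma (pm g) + mb (pm g)) (mc (pm g)) (mc (pm g) + md (pm g))).
  { rewrite pm_gmul, nrm_pos; unfold mmul; cbn [pm GT ma mb mc md]; [f_equal; ring|lia]. }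
  rewrite (cf_pt F' g (gmul g GT)), (cf_step F' (gmul g GT)), red_id.
  2,3: rewrite ET; cbn [ma mb mc md]; lia.
  2: { rewrite <- (gmul_1_r g) at 1; rewrite pt_eqb_gmul_both; reflexivity. }
  rewrite (cf_pt F' (gmul (gmul g GT) GS) (gmul g GUS)).
  2: { rewrite gmul_assoc, pt_eqb_gmul_both; reflexivity. }
  rewrite (cf_pt F' (gmul g GS) (gmul (gmul g GUS) GS)).
  2: { rewrite gmul_assoc, pt_eqb_gmul_both; reflexivity. }
  ring.
Qed.

(** Induction on c + |d|. If -c <= d < 0, then gUS has bottom row (c + d, d) up to sign, of size c <
    c + |d|. Outside -c <= d < c, passing to gS swaps |c| and |d|. *)
Lemma manin_all g : manin g.
Proof.
  remember (Z.to_nat (mc (pm g) + Z.abs (md (pm g)))) as n eqn:En.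
  revert g En; induction n as [n IHn] using lt_wf_ind; intros g En; subst n.
  (* Stated for every [h] of the size of [g], so that it also applies to gS. *)
  assert (Step : forall h, mc (pm h) + Z.abs (md (pm h)) = mc (pm g) + Z.abs (md (pm g)) ->
    - mc (pm h) <= md (pm h) < mc (pm h) -> manin h).
  { intros h Hm Hb. destruct (Z_lt_ge_dec (md (pm h)) 0); [|apply manin_red; lia].
    apply manin_step; [lia|].
    eapply IHn; [|reflexivity].
    pose proof (mc_nonneg (gmul h GUS)) as N.
    assert (E : Z.abs (mc (pm (gmul h GUS))) + Z.abs (md (pm (gmul h GUS)))
       = Z.abs (mc (pm h) + md (pm h)) + Z.abs (md (pm h))).
    { destruct (pm_gmul_eq h GUS) as [->| ->];
        change (pm GUS) with (M 1 0 1 1); unfold mmul, mneg; cbn [ma mb mc md]; lia. }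
    lia. }
  destruct (Z_le_gt_dec (- mc (pm g)) (md (pm g))); [destruct (Z_lt_ge_dec (md (pm g)) (mc (pm g)))|].
  1: apply Step; lia.
  all: apply manin_flip, Step; pose proof (mc_nonneg (gmul g GS)) as N; pose proof (mc_nonneg g);
    pose proof (pm_pos (gmul g GS)) as Q; apply posm_iff in Q; revert N Q;
    destruct (pm_gmul_eq g GS) as [->| ->];
    unfold mmul, mneg; cbn [pm GS ma mb mc md]; try lia.
Qed.
End Manin.

(** * The ideal [I_2] *)

(** I_2 as a set of coefficient functions, so that it is a [subgroup]. *)
Definition I2fun (f : G2 -> Z) : Prop :=
  exists r1 r2 r3 r4 : ZG2, forall g, f g =
    coeff2 (mulZG2 r1 gen1 ++ mulZG2 r2 gen2 ++ mulZG2 r3 gen3 ++ mulZG2 r4 gen4) g.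

Lemma I2fun_tr r1 r2 r3 r4 g :
  coeff2 (mulZG2 r1 gen1 ++ mulZG2 r2 gen2 ++ mulZG2 r3 gen3 ++ mulZG2 r4 gen4) g =
  lin (fun p => tr gen1 p g) r1 + (lin (fun p => tr gen2 p g) r2 +
  (lin (fun p => tr gen3 p g) r3 + lin (fun p => tr gen4 p g) r4)).
Proof. rewrite coeff2_lin, !lin_app, <- !coeff2_lin, !coeff2_mul; reflexivity. Qed.

Lemma lin_sub_app {K} (f : K -> Z) L L' :
  lin f (L ++ map (fun e => (- fst e, snd e)) L') = lin f L - lin f L'.
Proof. rewrite lin_app, lin_neg; ring. Qed.

Lemma I2fun_subgroup : subgroup I2fun.
Proof.
  split.
  - intros f g E (r1 & r2 & r3 & r4 & H). exists r1, r2, r3, r4; intro p.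
    rewrite <- E; apply H.
  - exists [], [], [], []; reflexivity.
  - intros f g (r1 & r2 & r3 & r4 & H) (s1 & s2 & s3 & s4 & H').
    exists (r1 ++ negZG2 s1), (r2 ++ negZG2 s2), (r3 ++ negZG2 s3), (r4 ++ negZG2 s4).
    intro p; rewrite H, H', !I2fun_tr; unfold negZG2; rewrite !lin_sub_app; ring.
Qed.

Lemma lin_1 {K} (f : K -> Z) k : lin f [(1, k)] = f k.
Proof. rewrite lin_cons; cbn [fst snd lin fold_right]; ring. Qed.

Lemma I2fun_gen y p : In y [gen1; gen2; gen3; gen4] -> I2fun (tr y p).
Proof.
  intros [<-|[<-|[<-|[<-|[]]]]].
  1: exists [(1, p)], [], [], [].
  2: exists [], [(1, p)], [], [].
  3: exists [], [], [(1, p)], [].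
  4: exists [], [], [], [(1, p)].
  all: intro g; rewrite I2fun_tr, lin_1; cbn [lin fold_right]; ring.
Qed.

Lemma in_I2_sub x y : I2fun (fun g => coeff2 x g - coeff2 y g) -> in_I2 (x ++ negZG2 y).
Proof.
  intros (r1 & r2 & r3 & r4 & H). exists r1, r2, r3, r4; intro g.
  rewrite <- H, !coeff2_lin; apply lin_sub_app.
Qed.

Lemma tr_tau a b g :
  tr one_plus_SS (a, b) g = delta (a, b) g + delta (gmul a GS, gmul b GS) g.
Proof.
  unfold tr, one_plus_SS, mul2; cbn [tens gen flat_map map app lin fold_right fst snd].
  rewrite !gmul_1_r; ring.
Qed.

(** As t(S,1) = (S,1) + (1,S), the first generator is Manin's S-relation for t in the first
    variable; [tr_gen1'] gives the second variable. *)
Lemma tr_gen1 a b g : tr gen1 (a, b) g = tr one_plus_SS (a, b) g + tr one_plus_SS (gmul a GS, b) g.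
Proof.
  rewrite !tr_tau, gmul_S_S.
  unfold tr, gen1, mul2; cbn [tens gen flat_map map app lin fold_right fst snd].
  rewrite !gmul_1_r; ring.
Qed.

Lemma tr_gen1' a b g : tr gen1 (a, b) g = tr one_plus_SS (a, b) g + tr one_plus_SS (a, gmul b GS) g.
Proof.
  rewrite tr_gen1, !tr_tau, !gmul_S_S; ring.
Qed.

Lemma tr_gen3 a b g :
  tr gen3 (a, b) g =
  tr one_plus_SS (a, b) g + tr one_plus_SS (gmul a GU, b) g + tr one_plus_SS (gmul a GU2, b) g.
Proof.
  unfold gen3; rewrite tr_mul.
  cbn [tens gen flat_map map app lin fold_right fst snd]; unfold mul2; cbn [fst snd].
  rewrite !gmul_1_r; ring.
Qed.

Lemma tr_gen4 a b g :
  tr gen4 (a, b) g =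
  tr one_plus_SS (a, b) g + tr one_plus_SS (a, gmul b GU) g + tr one_plus_SS (a, gmul b GU2) g.
Proof.
  unfold gen4; rewrite tr_mul.
  cbn [tens gen flat_map map app lin fold_right fst snd]; unfold mul2; cbn [fst snd].
  rewrite !gmul_1_r; ring.
Qed.

(** Expanding t(1,1) + t(1,U) + t(U,U), the terms (1,1) and (U,U) cancel against the U-relation and
    the rest is [gen2]. *)
Lemma tr_gen2 a b g :
  tr gen2 (a, b) g = tr one_plus_SS (a, b) g + tr one_plus_SS (a, gmul b GU) g
    + tr one_plus_SS (gmul a GU, gmul b GU) g
    - (delta (a, b) g + delta (gmul a GU, gmul b GU) g + delta (gmul a GU2, gmul b GU2) g).
Proof.
  rewrite !tr_tau, !gmul_assoc.
  unfold tr, gen2, mul2; cbn [tens gen negZG2 flat_map map app lin fold_right fst snd].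
  rewrite !gmul_1_r; unfold GUS; ring.
Qed.

(** * Reduction of I_D to combinations of the t(a,b) modulo I_2 *)

Definition modtau (f : G2 -> Z) : Prop :=
  exists y : ZG2, I2fun (fun g => f g - lin (fun p => tr one_plus_SS p g) y).

Lemma modtau_subgroup : subgroup modtau.
Proof.
  split.
  - intros f g E [y H]; exists y. eapply (sub_ext _ I2fun_subgroup); [|exact H].
    intro p; cbv beta; rewrite E; reflexivity.
  - exists []. eapply (sub_ext _ I2fun_subgroup); [|apply (sub_zero _ I2fun_subgroup)].
    intro; reflexivity.
  - intros f g [y H] [z H']; exists (y ++ negZG2 z).
    eapply (sub_ext _ I2fun_subgroup); [|apply (sub_sub _ I2fun_subgroup _ _ H H')].
    intro p; cbv beta; unfold negZG2; rewrite lin_sub_app; ring.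
Qed.

(** Parametrizes the pairs with b a^-1 = g by their first entry. *)
Definition diag (g a : PSL2) : G2 -> Z := delta (a, gmul g a).

Lemma diag_S g a : modtau (fun p => diag g a p + diag g (gmul a GS) p).
Proof.
  exists [(1, (a, gmul g a))].
  eapply (sub_ext _ I2fun_subgroup); [|apply (sub_zero _ I2fun_subgroup)].
  intro p; cbv beta; unfold diag; rewrite lin_1, tr_tau, gmul_assoc; ring.
Qed.

Lemma diag_U g a :
  modtau (fun p => diag g a p + diag g (gmul a GU) p + diag g (gmul a GU2) p).
Proof.
  (* The three t-terms of [tr_gen2]. *)
  exists [(1, (a, gmul g a)); (1, (a, gmul g (gmul a GU))); (1, (gmul a GU, gmul g (gmul a GU)))].
  eapply (sub_ext _ I2fun_subgroup);
    [|apply (sub_opp _ I2fun_subgroup), (I2fun_gen gen2 (a, gmul g a)); right; left; reflexivity].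
  intro p; cbv beta; rewrite tr_gen2. unfold diag.
  rewrite !lin_cons; cbn [fst snd lin fold_right]. rewrite !(gmul_assoc g); ring.
Qed.

(** Manin's theorem replaces each pair by s(a oo) - s(a 0) on its diagonal, and the condition
    defining I_D makes these differences sum to 0. *)
Lemma in_ID_modtau x : in_ID x -> modtau (coeff2 x).
Proof.
  intro HD; rewrite in_ID_lin in HD.
  set (q (p : G2) := gmul (snd p) (ginv (fst p))).
  assert (H : modtau (fun g =>
    lin (fun p => diag (q p) (fst p) g - cfd (fun a => diag (q p) a g) (fst p)) x)).
  { apply (sub_lin _ modtau_subgroup
      (fun p g => diag (q p) (fst p) g - cfd (fun a => diag (q p) a g) (fst p))).
    intro p. apply (manin_all modtau modtau_subgroup (diag (q p)) (diag_S _) (diag_U _)). }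
  eapply (sub_ext _ modtau_subgroup); [|exact H].
  intro g; cbv beta. rewrite lin_sub, coeff2_lin.
  rewrite (lin_ext (fun p => diag (q p) (fst p) g) (fun p => delta p g)).
  2:{ intros [a b]; unfold diag, q; cbn [fst snd].
      rewrite gmul_assoc, ginv_l, gmul_1_r; reflexivity. }
  (* A pair (h, c) stands for the cusp c oo on the diagonal h, so a 0 is encoded by aS. *)
  set (f (k : G2) := cf (fun a => diag (fst k) a g) (snd k)).
  rewrite (lin_ext (fun p => cfd _ (fst p))
    (fun p => lin f [(1, (q p, fst p)); (-1, (q p, gmul (fst p) GS))])).
  2:{ intro p; unfold f, cfd; rewrite !lin_cons; cbn [fst snd lin fold_right]; ring. }
  rewrite (lin_bind_zero (fun k l => eqG (fst k) (fst l) &&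
    pt_eqb (act (snd k) pinf) (act (snd l) pinf))%bool); [ring| | | | |].
  - intro k; rewrite andb_true_iff, eqG_eq, pt_eqb_true; auto.
  - intros k l; rewrite !andb_true_iff, !eqG_eq, pt_eqb_sym; intros [? ?]; auto.
  - intros k l m; rewrite !andb_true_iff, !eqG_eq; intros [-> ?] [-> ?]; split; [reflexivity|].
    eapply pt_eqb_trans; [|eassumption..]. apply act_nonzero; left; discriminate.
  - intros [h c]; cbn [fst snd].
    rewrite <- (HD h (act c pinf)) by (apply act_nonzero; left; discriminate).
    apply lin_ext; intro p. rewrite !lin_cons; cbn [fst snd lin fold_right].
    unfold dfun, pind; fold (q p). rewrite (pt_eqb_act_gmul (fst p) GS pinf).
    change (act GS pinf) with pzero.
    unfold ind; destruct (eqG (q p) h); cbn [andb]; ring.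
  - intros [h c] [h' c']; cbn [fst snd]; rewrite andb_true_iff, eqG_eq; intros [-> E].
    unfold f; cbn [fst snd]. apply cf_pt, E.
Qed.

(** * Combinations of the t(a,b) without horizontal boundary *)

(** Manin's theorem in the first variable, by [gen1] and [gen3], then in the second, by [gen1] and
    [gen4]. *)
Lemma tau_tensor a b :
  I2fun (fun g => tr one_plus_SS (a, b) g - cfd (fun b => cfd (fun a => tr one_plus_SS (a, b) g) a) b).
Proof.
  assert (A : I2fun (fun g => tr one_plus_SS (a, b) g - cfd (fun a => tr one_plus_SS (a, b) g) a)).
  { apply (manin_all I2fun I2fun_subgroup (fun a => tr one_plus_SS (a, b))).
    - intro h. eapply (sub_ext _ I2fun_subgroup);
        [|apply (I2fun_gen gen1 (h, b)); left; reflexivity].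
      intro g; apply tr_gen1.
    - intro h. eapply (sub_ext _ I2fun_subgroup);
        [|apply (I2fun_gen gen3 (h, b)); do 2 right; left; reflexivity].
      intro g; apply tr_gen3. }
  assert (B : I2fun (fun g => cfd (fun a => tr one_plus_SS (a, b) g) a
      - cfd (fun b => cfd (fun a => tr one_plus_SS (a, b) g) a) b)).
  { apply (manin_all I2fun I2fun_subgroup (fun b g => cfd (fun a => tr one_plus_SS (a, b) g) a)).
    - intro h. eapply (sub_ext _ I2fun_subgroup);
        [|apply (cfd_subgroup _ I2fun_subgroup (fun a => tr gen1 (a, h)));
          intro; apply I2fun_gen; left; reflexivity].
      intro g; cbv beta. rewrite <- cfd_add; apply cfd_ext; intro; apply tr_gen1'.
    - intro h. eapply (sub_ext _ I2fun_subgroup);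
        [|apply (cfd_subgroup _ I2fun_subgroup (fun a => tr gen4 (a, h)));
          intro; apply I2fun_gen; do 3 right; left; reflexivity].
      intro g; cbv beta. rewrite <- !cfd_add; apply cfd_ext; intro; apply tr_gen4. }
  eapply (sub_ext _ I2fun_subgroup); [|apply (sub_add _ I2fun_subgroup _ _ A B)].
  intro g; cbv beta; ring.
Qed.

(** S reverses the boundary of a and exchanges b oo with b 0, so the two terms of t(a,b) combine
    into a tensor product. *)
Lemma lin_hfun_tau y v w :
  lin (hfun v w) (mulZG2 y one_plus_SS) = lin (fun p => pind (fst p) v * pind (snd p) w) y.
Proof.
  rewrite lin_mulZG2; apply lin_ext; intros [a b].
  unfold one_plus_SS, mul2; cbn [tens gen flat_map map app lin fold_right fst snd].
  unfold hfun, pind; cbn [fst snd]. rewrite !gmul_1_r, !pt_eqb_act_gmul.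
  change (act GS pinf) with pzero. change (act GS pzero) with (-1, 0).
  assert (E : forall z, pt_eqb (act a (-1, 0)) z = pt_eqb (act a pinf) z).
  { intro z; rewrite !pt_eqb_act_l; apply (pt_eqb_opp_l 1 0). }
  rewrite E; ring.
Qed.

Lemma tau_kernel y :
  (forall a b, lin (hfun (act a pinf) (act b pinf)) (mulZG2 y one_plus_SS) = 0) ->
  I2fun (coeff2 (mulZG2 y one_plus_SS)).
Proof.
  intro H.
  eapply (sub_ext _ I2fun_subgroup);
    [|apply (sub_lin _ I2fun_subgroup _ y (fun p => tau_tensor (fst p) (snd p)))].
  intro g; cbv beta.
  (* A function of pairs of cusps; the four terms below expand the tensor product of the two
     boundaries. *)
  set (f (k : G2) := cf (fun b => cf (fun a => tr one_plus_SS (a, b) g) (fst k)) (snd k)).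
  rewrite lin_sub, coeff2_mul,
    (lin_ext (fun p => tr one_plus_SS (fst p, snd p) g) (fun p => tr one_plus_SS p g))
    by (intros []; reflexivity).
  rewrite (lin_ext (fun p => cfd _ (snd p))
    (fun p => lin f [(1, p); (-1, (gmul (fst p) GS, snd p)); (-1, (fst p, gmul (snd p) GS));
                     (1, (gmul (fst p) GS, gmul (snd p) GS))])).
  2:{ intros [a b]. unfold f, cfd; rewrite !cf_sub, !lin_cons; cbn [fst snd lin fold_right]; ring. }
  rewrite (lin_bind_zero (fun k l => pt_eqb (act (fst k) pinf) (act (fst l) pinf) &&
    pt_eqb (act (snd k) pinf) (act (snd l) pinf))%bool); [ring| | | | |].
  - intro k; rewrite andb_true_iff, !pt_eqb_true; auto.
  - intros k l; rewrite !andb_true_iff, (pt_eqb_sym (act (fst k) _)), (pt_eqb_sym (act (snd k) _)); auto.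
  - intros k l m; rewrite !andb_true_iff; intros [? ?] [? ?].
    split; (eapply pt_eqb_trans; [|eassumption..]; apply act_nonzero; left; discriminate).
  - intros [c d]; cbn [fst snd]. rewrite <- (H c d), lin_hfun_tau.
    apply lin_ext; intros [a b]. rewrite !lin_cons; cbn [fst snd lin fold_right].
    rewrite !pt_eqb_act_gmul. change (act GS pinf) with pzero. unfold pind.
    unfold ind; repeat match goal with |- context [pt_eqb ?u ?v] => destruct (pt_eqb u v) end;
      cbn [andb]; ring.
  - intros [c d] [c' d']; cbn [fst snd]; rewrite andb_true_iff; intros [E E'].
    unfold f; cbn [fst snd]. rewrite (cf_pt _ d d' E').
    apply cf_ext; intro; apply cf_pt, E.
Qed.

Theorem theorem3 : forall x : ZG2, (in_IH x /\ in_IV x /\ in_ID x) <-> in_I2 x.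
Proof.
  intro x; split; [|intro H; split; [|split]; [apply I2_sub_IH|apply I2_sub_IV|apply I2_sub_ID]; exact H].
  intros (HH & _ & HD).
  destruct (in_ID_modtau x HD) as [y Hy].
  assert (E : I2fun (fun g => coeff2 x g - coeff2 (mulZG2 y one_plus_SS) g)).
  { eapply (sub_ext _ I2fun_subgroup); [|exact Hy].
    intro g; cbv beta; rewrite coeff2_mul; reflexivity. }
  assert (K : I2fun (coeff2 (mulZG2 y one_plus_SS))).
  { apply tau_kernel; intros a b.
    (* Both x and its difference from the combination of t-terms have zero horizontal boundary,
       hence so does the combination. *)
    pose proof (I2_sub_IH _ (in_I2_sub _ _ E)) as H; rewrite in_IH_lin in H, HH.
    assert (N : pt_nonzero (act a pinf)) by (apply act_nonzero; left; discriminate).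
    specialize (H b _ N); specialize (HH b _ N).
    unfold negZG2 in H; rewrite lin_sub_app in H; lia. }
  destruct (sub_add _ I2fun_subgroup _ _ E K) as (r1 & r2 & r3 & r4 & H).
  exists r1, r2, r3, r4; intro g; rewrite <- H; ring.
Qed.
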